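(* Let $A$ be an associative algebra over a field and let $\sigma:A\to A$ be an anti-involution. For $a\in A$ put $\widehat{a}:=a-\sigma(a)$, and let $\mathcal{L}(A)=\mathrm{span}\{\widehat{a}\mid a\in A\}\subseteq A$. Then: (i) For all $a,b\in A$, $$[\widehat{a},\widehat{b}]=\widehat{ab}-\widehat{a\sigma(b)}-\widehat{\sigma(a)b}+\widehat{\sigma(a)\sigma(b)}\in\mathcal{L}(A).$$ (ii) $\mathcal{L}(A)$ is a Lie algebra, with the Lie bracket induced from $A$.
   Context: An anti-involution of an associative algebra $A$ over a field $K$ is a $K$-linear map $\sigma:A\to A$ with $\sigma(ab)=\sigma(b)\sigma(a)$ for all $a,b\in A$ and $\sigma^2=\mathrm{id}_A$. The algebra $A$ is regarded as a Lie algebra with bracket $[a,b]=ab-ba$. *)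

(* Defs.v *)
From HB Require Import structures.
From mathcomp Require Import all_boot all_algebra.
From mathcomp Require Import boolp.

Set Implicit Arguments.
Unset Strict Implicit.
Unset Printing Implicit Defensive.

Import GRing.Theory.
Local Open Scope ring_scope.

(* An associative K-algebra is given here by a K-vector space A of arbitrary
   dimension and an associative product mul : {bilinear A -> A -> A}. No unit
   is assumed, which rules out the library's (unital) algType. *)

Section Span.
Variables (K : fieldType) (V : lmodType K).

(* The set of finite linear combinations of elements of S. The library's
   <<X>>%VS only covers finite sequences X in finite-dimensional spaces. *)
Definition lspan (S : V -> Prop) : {pred V} :=
  fun x => `[< exists n (c : 'I_n -> K) (v : 'I_n -> V),
                 (forall i, S (v i)) /\ x = \sum_(i < n) c i *: v i >].

Lemma lspanP (S : V -> Prop) (x : V) :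
  reflect (exists n (c : 'I_n -> K) (v : 'I_n -> V),
             (forall i, S (v i)) /\ x = \sum_(i < n) c i *: v i)
          (x \in lspan S).
Proof. exact: asboolP. Qed.

Lemma lspan_submod_closed (S : V -> Prop) : submod_closed (lspan S).
Proof.
split=> [|a x y /lspanP[n [c [v [Sv ->]]]] /lspanP[m [d [w [Sw ->]]]]].
  by apply/lspanP; exists 0, (fun=> 0), (fun=> 0); split=> [[]|] //; rewrite big_ord0.
apply/lspanP; exists (n + m)%N.
exists (fun i => match split i with inl j => a * c j | inr k => d k end).
exists (fun i => match split i with inl j => v j | inr k => w k end).
split=> [i|]; first by case: (split i).
rewrite big_split_ord /= scaler_sumr; congr (_ + _); apply: eq_bigr => i _.
  by rewrite (unsplitK (inl i)) scalerA.
by rewrite (unsplitK (inr i)).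
Qed.

HB.instance Definition _ (S : V -> Prop) :=
  GRing.isSubmodClosed.Build K V (lspan S) (lspan_submod_closed S).

Definition lspan_of (S : V -> Prop) := {x : V | x \in lspan S}.

HB.instance Definition _ (S : V -> Prop) :=
  [isSub of lspan_of S for @sval V (fun x => x \in lspan S)].
HB.instance Definition _ (S : V -> Prop) := [Choice of lspan_of S by <:].
HB.instance Definition _ (S : V -> Prop) :=
  [SubChoice_isSubLmodule of lspan_of S by <:].

End Span.

(* Together with bilinearity, the axioms of a Lie algebra over K. *)
Definition lie_axioms (K : fieldType) (V : lmodType K)
    (br : {bilinear V -> V -> V}) : Prop :=
  (forall x, br x x = 0) /\
  (forall x y z, br x (br y z) + br y (br z x) + br z (br x y) = 0).

Section AntiInvolution.
Variables (K : fieldType) (A : lmodType K).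

Definition bracket (mul : A -> A -> A) (a b : A) : A := mul a b - mul b a.

Definition anti_involution (mul : A -> A -> A) (sigma : {linear A -> A}) : Prop :=
  (forall a b, sigma (mul a b) = mul (sigma b) (sigma a)) /\
  (forall a, sigma (sigma a) = a).

Definition hat (sigma : A -> A) (a : A) : A := a - sigma a.

Definition hat_set (sigma : A -> A) (x : A) : Prop := exists a, x = hat sigma a.

Definition Lhat (sigma : A -> A) : {pred A} := lspan (hat_set sigma).

(* The elements of Lhat sigma as a type, with its vector space structure
   inherited from A. *)
Definition Lhat_of (sigma : A -> A) : lmodType K := lspan_of (hat_set sigma).

Definition Lhat_val (sigma : A -> A) : Lhat_of sigma -> A :=
  fun x => \val (x : lspan_of (hat_set sigma)).

End AntiInvolution.

(* Main.v *)
(* Since a |-> hat a is linear, its image is already a subspace, so every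
   element of L(A) is a single hat a; closure of L(A) under the bracket is then
   just the formula in (i). *)
Require Import Defs.
From HB Require Import structures.
From mathcomp Require Import all_boot all_algebra.
Import GRing.Theory.
Local Open Scope ring_scope.

(** Expanding both sides of the formula with [sigma] reversing products and squaring to the identity
    gives the same eight signed monomials ([bracket_hat]). As elements of L(A) are single hats
    ([LhatP]), the commutator restricts to L(A) ([mem_bracket]); bilinearity and the Lie identities
    are then inherited from A along the injective inclusion. *)

Section Bracket.
Context {K : fieldType} {A : lmodType K} (mul : {bilinear A -> A -> A}).

Lemma bracket_bilinear : bilinear_for *:%R *:%R (bracket mul).
Proof.
split=> [z|z] c x y; rewrite /bracket linearPl linearPr /= scalerBr opprD;
  by rewrite addrACA.
Qed.

Lemma bracketxx x : bracket mul x x = 0.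
Proof. exact: subrr. Qed.

Lemma bracket_jacobi (mulA : associative mul) x y z :
  bracket mul x (bracket mul y z) + bracket mul y (bracket mul z x)
    + bracket mul z (bracket mul x y) = 0.
Proof.
rewrite /bracket !linearBl !linearBr !opprB !mulA !addrA.
(* Of the twelve signed triple products, each is paired with its negative, the positive one
   first. *)
rewrite (ACl ((1*12)*(3*10)*(5*4)*(7*2)*(9*8)*(11*6))) /=.
by rewrite !subrr !addr0.
Qed.

End Bracket.

Section Hat.
Context {K : fieldType} {A : lmodType K}.
Implicit Type sigma : {linear A -> A}.

Lemma mem_hat sigma a : hat sigma a \in Lhat sigma.
Proof.
apply/lspanP; exists 1, (fun=> 1), (fun=> hat sigma a).
by split=> [_|]; [exists a | rewrite big_ord1 scale1r].
Qed.

Lemma LhatP sigma x : x \in Lhat sigma -> exists a, x = hat sigma a.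
Proof.
(* Finite choice gives preimages [a i] of all the [v i]; the same combination of them is a preimage
   of [x]. *)
case/lspanP=> n [c [v [/fin_all_exists[a va] ->]]].
exists (\sum_(i < n) c i *: a i); rewrite /hat linear_sum -sumrB.
by apply: eq_bigr => i _; rewrite va linearZ_LR -scalerBr.
Qed.

Context {mul : {bilinear A -> A -> A}} {sigma : {linear A -> A}}.
Hypothesis sigma_anti : anti_involution mul sigma.

Lemma bracket_hat a b :
  bracket mul (hat sigma a) (hat sigma b) =
    hat sigma (mul a b) - hat sigma (mul a (sigma b))
    - hat sigma (mul (sigma a) b) + hat sigma (mul (sigma a) (sigma b)).
Proof.
have [sM sK] := sigma_anti.
rewrite /bracket /hat !sM !sK !linearBl !linearBr !(opprB, opprD, opprK) !addrA.
(* The permutation puts the eight monomials in the order of the right-hand side. *)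
by rewrite [LHS](ACl (1*8*5*2*7*4*3*6)).
Qed.

Lemma mem_bracket {x y} :
  x \in Lhat sigma -> y \in Lhat sigma -> bracket mul x y \in Lhat sigma.
Proof.
move=> /LhatP[a ->] /LhatP[b ->].
rewrite bracket_hat; apply: rpredD; last exact: mem_hat.
by apply: rpredB; first apply: rpredB; apply: mem_hat.
Qed.

(** Bundling the value with its membership proof makes [Lhat_val] preserve brackets by
    computation. *)
Definition Lhat_bracket (x y : Lhat_of sigma) : Lhat_of sigma :=
  exist _ (bracket mul (Lhat_val x) (Lhat_val y))
    (mem_bracket (svalP x) (svalP y)).

Lemma Lhat_bracket_bilinear : bilinear_for *:%R *:%R Lhat_bracket.
Proof.
have valP c (u v : Lhat_of sigma) :
  Lhat_val (c *: u + v) = c *: Lhat_val u + Lhat_val v by [].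
have [brl brr] := bracket_bilinear mul.
split=> [z|z] c x y; apply: val_inj.
  rewrite -[LHS]/(bracket mul (Lhat_val (c *: x + y)) (Lhat_val z)) valP.
  exact: (brl (Lhat_val z)).
rewrite -[LHS]/(bracket mul (Lhat_val z) (Lhat_val (c *: x + y))) valP.
exact: (brr (Lhat_val z)).
Qed.

HB.instance Definition _ :=
  bilinear_isBilinear.Build K _ _ _ _ _ Lhat_bracket Lhat_bracket_bilinear.

End Hat.

Theorem lemma3p2 (K : fieldType) (A : lmodType K)
    (mul : {bilinear A -> A -> A}) (mulA : associative mul)
    (sigma : {linear A -> A}) (sigma_anti : anti_involution mul sigma) :
  (forall a b : A,
     bracket mul (hat sigma a) (hat sigma b) =
       hat sigma (mul a b) - hat sigma (mul a (sigma b))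
       - hat sigma (mul (sigma a) b) + hat sigma (mul (sigma a) (sigma b))
     /\ bracket mul (hat sigma a) (hat sigma b) \in Lhat sigma) /\
  (exists br : {bilinear Lhat_of sigma -> Lhat_of sigma -> Lhat_of sigma},
     lie_axioms br /\
     (forall x y : Lhat_of sigma,
        Lhat_val (br x y) = bracket mul (Lhat_val x) (Lhat_val y))).
Proof.
split=> [a b|].
  split; first exact: bracket_hat.
  by apply: (mem_bracket sigma_anti); apply: mem_hat.
exists (Lhat_bracket sigma_anti : {bilinear _ -> _ -> _}); split=> //.
(* Both identities can be checked in A, since the inclusion is injective. *)
split=> [x|x y z]; apply: val_inj => /=; first exact: bracketxx.
exact: bracket_jacobi.
Qed.
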